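(* Let $S$ be any set of sentence symbols and let $v : S \to \{T,F\}$ be any function (a truth assignment for $S$). Then there exists a unique function $\overline{v} : \overline{S} \to \{T,F\}$ satisfying all of the following conditions: 0. For every sentence symbol $A \in S$, $\overline{v}(A) = v(A)$. And for all $\alpha, \beta \in \overline{S}$: 1. $\overline{v}((\neg \alpha)) = T$ if $\overline{v}(\alpha) = F$, and $\overline{v}((\neg\alpha)) = F$ if $\overline{v}(\alpha) = T$. 2. $\overline{v}((\alpha \wedge \beta)) = T$ if $\overline{v}(\alpha) = \overline{v}(\beta) = T$, and $F$ otherwise. 3. $\overline{v}((\alpha \vee \beta)) = T$ if $\overline{v}(\alpha) = T$ or $\overline{v}(\beta) = T$ (or both), and $F$ otherwise. 4. $\overline{v}((\alpha \rightarrow \beta)) = F$ if $\overline{v}(\alpha) = T$ and $\overline{v}(\beta) = F$, and $T$ otherwise. 5. $\overline{v}((\alpha \leftrightarrow \beta)) = T$ if $\overline{v}(\alpha) = \overline{v}(\beta)$, and $F$ otherwise.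
   Context: The language of sentential logic (LSL) has as symbols the two parentheses $($ and $)$, the connectives $\neg, \wedge, \vee, \rightarrow, \leftrightarrow$, and the sentence symbols $A_1, A_2, A_3, \dots$; all these symbols are distinct. An expression is a finite sequence of symbols; a sentence symbol is identified with the corresponding expression of length one. For arbitrary expressions $\alpha,\beta$ the formula-building operations are defined by concatenation: $\varepsilon_\neg(\alpha) = (\neg\alpha)$ and $\varepsilon_\square(\alpha,\beta) = (\alpha \,\square\, \beta)$ for $\square \in \{\wedge,\vee,\rightarrow,\leftrightarrow\}$. A construction sequence is a finite sequence $\langle \varepsilon_1,\dots,\varepsilon_n\rangle$ ($n \ge 1$) of expressions such that for every $i \le n$, either $\varepsilon_i$ is a sentence symbol, or $\varepsilon_i = \varepsilon_\neg(\varepsilon_j)$ for some $j<i$, or $\varepsilon_i = \varepsilon_\square(\varepsilon_j,\varepsilon_k)$ for some $j,k<i$ and some $\square \in \{\wedge,\vee,\rightarrow,\leftrightarrow\}$. An expression $\alpha$ is a well-formed formula (wff) if there is a construction sequence $\langle \varepsilon_1,\dots,\varepsilon_n\rangle$ with $\varepsilon_n = \alpha$. For a set $S$ of sentence symbols, $\overline{S}$ is the set of all wffs $\alpha$ such that every sentence symbol occurring in $\alpha$ belongs to $S$. The truth values $T$ and $F$ are two distinct objects. *)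

(* Defs.v *)
From HB Require Import structures.
From mathcomp Require Import all_boot.
From mathcomp Require Import boolp classical_sets.

Set Implicit Arguments.
Unset Strict Implicit.
Unset Printing Implicit Defensive.

(* [SentSym n] is the symbol A_{n+1}. *)
Inductive sentsym : Type := SentSym of nat.

Inductive binconn : Type := And | Or | Imp | Iff.

Inductive symbol : Type :=
  LParen | RParen | Neg | Bin of binconn | Sent of sentsym.

Lemma symbol_eq_dec : comparable symbol.
Proof. rewrite /comparable /decidable; repeat decide equality. Qed.

HB.instance Definition _ := hasDecEq.Build symbol (compareP symbol_eq_dec).

Definition expr : Type := seq symbol.

Definition esent (A : sentsym) : expr := [:: Sent A].

Definition eneg (a : expr) : expr := [:: LParen; Neg] ++ a ++ [:: RParen].

Definition ebin (c : binconn) (a b : expr) : expr :=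
  [:: LParen] ++ a ++ [:: Bin c] ++ b ++ [:: RParen].

(* The entry e_(i+1) of the sequence is [nth [::] s i]; the default value [::]
   is never reached, since all the indices below are smaller than [size s]. *)
Definition construction_sequence (s : seq expr) : Prop :=
  0 < size s /\
  forall i, i < size s ->
    [\/ exists A, nth [::] s i = esent A,
        exists2 j, j < i & nth [::] s i = eneg (nth [::] s j)
      | exists j k c, [/\ j < i, k < i &
          nth [::] s i = ebin c (nth [::] s j) (nth [::] s k)]].

Definition wff (a : expr) : Prop :=
  exists2 s, construction_sequence s & last [::] s = a.

Definition Sbar (S : set sentsym) : set expr :=
  [set a | wff a /\ forall A, Sent A \in a -> S A]%classic.

Lemma wff_sent (A : sentsym) : wff (esent A).
Proof.
exists [:: esent A] => //; split=> // -[|//] _.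
by apply: Or31; exists A.
Qed.

Lemma construction_sequence_rcons (s : seq expr) (a : expr) :
  construction_sequence s ->
  [\/ exists A, a = esent A,
      exists2 j, j < size s & a = eneg (nth [::] s j)
    | exists j k c, [/\ j < size s, k < size s &
        a = ebin c (nth [::] s j) (nth [::] s k)]] ->
  construction_sequence (rcons s a).
Proof.
move=> [_ cs] ca; split=> [|i]; first by rewrite size_rcons.
rewrite size_rcons ltnS leq_eqVlt => /orP[/eqP-> | lti].
  rewrite nth_rcons ltnn eqxx; case: ca => [[A ->]|[j jn ->]|[j [k [c [jn kn ->]]]]].
  - by apply: Or31; exists A.
  - by apply: Or32; exists j; rewrite // nth_rcons jn.
  - by apply: Or33; exists j, k, c; rewrite !nth_rcons jn kn.
rewrite nth_rcons lti; case: (cs i lti) => [[A ->]|[j ji ->]|[j [k [c [ji ki ->]]]]].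
- by apply: Or31; exists A.
- by apply: Or32; exists j; rewrite // nth_rcons (ltn_trans ji lti).
- by apply: Or33; exists j, k, c;
    rewrite !nth_rcons (ltn_trans ji lti) (ltn_trans ki lti).
Qed.

Lemma construction_sequence_cat (s t : seq expr) :
  construction_sequence s -> construction_sequence t ->
  construction_sequence (s ++ t).
Proof.
move=> [s0 cs] [t0 ct]; split=> [|i]; first by rewrite size_cat addn_gt0 s0.
rewrite size_cat => lti; rewrite nth_cat; case: ltnP => [si|si].
  case: (cs i si) => [[A ->]|[j ji ->]|[j [k [c [ji ki ->]]]]].
  - by apply: Or31; exists A.
  - by apply: Or32; exists j; rewrite // nth_cat (ltn_trans ji si).
  - by apply: Or33; exists j, k, c;
      rewrite !nth_cat (ltn_trans ji si) (ltn_trans ki si).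
have ti : i - size s < size t by rewrite ltn_subLR.
have sh j : j < i - size s -> size s + j < i by rewrite ltn_subRL.
have nsh j : nth [::] (s ++ t) (size s + j) = nth [::] t j.
  by rewrite nth_cat ltnNge leq_addr /= addKn.
case: (ct _ ti) => [[A ->]|[j ji ->]|[j [k [c [ji ki ->]]]]].
- by apply: Or31; exists A.
- by apply: Or32; exists (size s + j); rewrite ?nsh ?sh.
- by apply: Or33; exists (size s + j), (size s + k), c; rewrite !nsh !sh.
Qed.

Lemma wff_neg (a : expr) : wff a -> wff (eneg a).
Proof.
move=> [s cs <-]; exists (rcons s (eneg (last [::] s))); last by rewrite last_rcons.
apply: construction_sequence_rcons => //; apply: Or32; exists (size s).-1.
  by case: cs => s0 _; rewrite prednK.
by rewrite nth_last.
Qed.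

Lemma wff_bin (c : binconn) (a b : expr) : wff a -> wff b -> wff (ebin c a b).
Proof.
move=> [s cs <-] [t ct <-]; have [[s0 _] [t0 _]] := (cs, ct).
exists (rcons (s ++ t) (ebin c (last [::] s) (last [::] t))); last first.
  by rewrite last_rcons.
apply: construction_sequence_rcons; first exact: construction_sequence_cat.
apply: Or33; exists (size s).-1, (size s + (size t).-1), c.
rewrite size_cat; split; first by rewrite prednK // leq_addr.
  by rewrite ltn_add2l prednK.
by rewrite !nth_cat prednK // leqnn ltnNge leq_addr /= addKn !nth_last.
Qed.

Lemma Sbar_sent (S : set sentsym) (A : S) : esent (val A) \in Sbar S.
Proof.
apply/mem_set; split; first exact: wff_sent.
by move=> B; rewrite mem_seq1 => /eqP[->]; exact: set_mem (valP A).
Qed.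

Lemma Sbar_neg (S : set sentsym) (a : Sbar S) : eneg (val a) \in Sbar S.
Proof.
have [wa Sa] := set_mem (valP a).
apply/mem_set; split; first exact: wff_neg.
by move=> A; rewrite !(mem_cat, inE) => /or3P[/orP[]/eqP|/Sa|/eqP].
Qed.

Lemma Sbar_bin (S : set sentsym) (c : binconn) (a b : Sbar S) :
  ebin c (val a) (val b) \in Sbar S.
Proof.
have [wa Sa] := set_mem (valP a); have [wb Sb] := set_mem (valP b).
apply/mem_set; split; first exact: wff_bin.
by move=> A; rewrite !(mem_cat, inE) => /or3P[/eqP|/Sa|/or3P[/eqP|/Sb|/eqP]].
Qed.

(* The formula-building operations as maps between the subtypes S and Sbar S,
   so that a function on Sbar S can be applied to their results. *)
Definition sent_in (S : set sentsym) (A : S) : Sbar S :=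
  exist _ (esent (val A)) (Sbar_sent A).

Definition neg_in (S : set sentsym) (a : Sbar S) : Sbar S :=
  exist _ (eneg (val a)) (Sbar_neg a).

Definition bin_in (S : set sentsym) (c : binconn) (a b : Sbar S) : Sbar S :=
  exist _ (ebin c (val a) (val b)) (Sbar_bin c a b).

(* Main.v *)
Require Import Defs.
From mathcomp Require Import all_boot.
From mathcomp Require Import boolp classical_sets.

(* Wffs are exactly the printed forms of abstract syntax trees. Printing is
   injective: since each compound expression opens with a parenthesis and its
   next symbols reveal its shape, a tree can be read back from any expression
   that begins with its printed form. Hence evaluation of trees transfers to
   wffs; uniqueness is induction on wffs. *)

Inductive formula : Type :=
  FSent of sentsym | FNeg of formula | FBin of binconn & formula & formula.

Fixpoint print (f : formula) : expr :=
  match f with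
  | FSent A => esent A
  | FNeg f => eneg (print f)
  | FBin c f g => ebin c (print f) (print g)
  end.

Definition truth_fun (c : binconn) : bool -> bool -> bool :=
  match c with And => andb | Or => orb | Imp => implb | Iff => eqb end.

Fixpoint eval (w : sentsym -> bool) (f : formula) : bool :=
  match f with
  | FSent A => w A
  | FNeg f => ~~ eval w f
  | FBin c f g => truth_fun c (eval w f) (eval w g)
  end.

(** A printed tree begins with a sentence symbol or a left parenthesis. This tells a negation from a
    binary compound once their common opening parenthesis is removed. *)
Lemma print_neq_Neg (f : formula) (s t : expr) : print f ++ s <> Neg :: t.
Proof. by case: f. Qed.

(* The trailing expressions make the induction go through: they carry the part
   of the input that is still to be read. *)
Lemma print_cat_inj (f g : formula) (s t : expr) :
  print f ++ s = print g ++ t -> f = g /\ s = t.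
Proof.
elim: f g s t => [A|f IHf|c f1 IH1 f2 IH2] [B|g|d g1 g2] s t //=.
- by case=> -> ->.
- by case; rewrite -!catA => /IHf[-> [->]].
- by case; rewrite -!catA => /esym/print_neq_Neg.
- by case; rewrite -!catA => /print_neq_Neg.
- case; rewrite -!catA => /IH1[->] /= [->].
  by rewrite -!catA => /IH2[-> [->]].
Qed.

Lemma print_inj : injective print.
Proof.
by move=> f g fg; case: (print_cat_inj f g [::] [::]); rewrite ?fg.
Qed.

Lemma wff_print (f : formula) : wff (print f).
Proof.
elim: f => [A|f|c f IHf g IHg] /=; [exact: wff_sent|exact: wff_neg|].
exact: wff_bin.
Qed.

Lemma wffP (a : expr) : wff a <-> exists f, print f = a.
Proof.
split=> [[s [s0 cs] <-]|[f <-]]; last exact: wff_print.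
(* Strong induction needs the claim for every entry, because an entry may refer back to any earlier
   one. *)
have printed i : i < size s -> exists f, print f = nth [::] s i.
  elim/ltn_ind: i => i IH si.
  case: (cs i si) => [[A ->]|[j ji ->]|[j [k [c [ji ki ->]]]]].
  - by exists (FSent A).
  - by have [f <-] := IH j ji (ltn_trans ji si); exists (FNeg f).
  - have [f <-] := IH j ji (ltn_trans ji si).
    have [g <-] := IH k ki (ltn_trans ki si).
    by exists (FBin c f g).
by rewrite -nth_last; apply: printed; rewrite prednK.
Qed.

(** Induction can stay inside [Sbar S] because each symbol of a component also occurs in the
    compound, so the components of a member are members too. *)
Lemma Sbar_ind {S : set sentsym} (P : Sbar S -> Prop) :
  (forall A, P (sent_in A)) ->
  (forall a, P a -> P (neg_in a)) ->
  (forall c a b, P a -> P b -> P (bin_in c a b)) ->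
  forall a, P a.
Proof.
move=> Psent Pneg Pbin a.
have [/wffP[f fa] _] := set_mem (valP a).
(* The member [a] is generalized along with its tree, so that the induction hypotheses apply to the
   components as members of [Sbar S]. *)
elim: f a fa => [A|f IHf|c f IHf g IHg] a fa;
    have [_ Sa] := set_mem (valP a); rewrite -fa /= in Sa.
- have SA : A \in S by apply/mem_set/Sa; rewrite mem_seq1.
  by rewrite (_ : a = sent_in (exist _ A SA)) //; apply: val_inj; rewrite -fa.
- have Sf : print f \in Sbar S.
    apply/mem_set; split; first exact: wff_print.
    by move=> A Af; apply: Sa; rewrite !(mem_cat, inE) Af orbT.
  rewrite (_ : a = neg_in (exist _ (print f) Sf)).
    exact/Pneg/IHf.
  by apply: val_inj; rewrite -fa.
- have Sf : print f \in Sbar S.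
    apply/mem_set; split; first exact: wff_print.
    by move=> A Af; apply: Sa; rewrite !(mem_cat, inE) Af ?orbT.
  have Sg : print g \in Sbar S.
    apply/mem_set; split; first exact: wff_print.
    by move=> A Ag; apply: Sa; rewrite !(mem_cat, inE) Ag ?orbT.
  rewrite (_ : a = bin_in c (exist _ (print f) Sf) (exist _ (print g) Sg)).
    by apply: Pbin; [exact: IHf|exact: IHg].
  by apply: val_inj; rewrite -fa.
Qed.

(** The tree is picked by choice; [print_inj] makes it the only candidate. *)
Definition parse {S : set sentsym} (a : Sbar S) : formula :=
  projT1 (cid (proj1 (wffP (val a)) (proj1 (set_mem (valP a))))).

Lemma parseK {S : set sentsym} (a : Sbar S) : print (parse a) = val a.
Proof. by rewrite /parse; case: cid. Qed.

(** Unique readability enters here and in the next two lemmas: both sides print to the same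
    expression, hence are the same tree. *)
Lemma parse_sent {S : set sentsym} (A : S) : parse (sent_in A) = FSent (val A).
Proof. by apply: print_inj; rewrite parseK. Qed.

Lemma parse_neg {S : set sentsym} (a : Sbar S) :
  parse (neg_in a) = FNeg (parse a).
Proof. by apply: print_inj; rewrite /= !parseK. Qed.

Lemma parse_bin {S : set sentsym} (c : binconn) (a b : Sbar S) :
  parse (bin_in c a b) = FBin c (parse a) (parse b).
Proof. by apply: print_inj; rewrite /= !parseK. Qed.

(* Takes the junk value [false] outside [S]. *)
Definition extend_assignment {S : set sentsym} (v : S -> bool) (A : sentsym) :
  bool := if insub A is Some B then v B else false.

Lemma extend_assignmentE {S : set sentsym} (v : S -> bool) (A : S) :
  extend_assignment v (val A) = v A.
Proof. by rewrite /extend_assignment valK. Qed.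

Theorem mainTheorem1 (S : set sentsym) (v : S -> bool) :
  exists! vbar : Sbar S -> bool,
    (forall A : S, vbar (sent_in A) = v A) /\
    (forall a b : Sbar S,
      [/\ (vbar a = false -> vbar (neg_in a) = true) /\
          (vbar a = true -> vbar (neg_in a) = false),
          (vbar a = true /\ vbar b = true -> vbar (bin_in And a b) = true) /\
          (~ (vbar a = true /\ vbar b = true) ->
             vbar (bin_in And a b) = false),
          (vbar a = true \/ vbar b = true -> vbar (bin_in Or a b) = true) /\
          (~ (vbar a = true \/ vbar b = true) ->
             vbar (bin_in Or a b) = false),
          (vbar a = true /\ vbar b = false -> vbar (bin_in Imp a b) = false) /\
          (~ (vbar a = true /\ vbar b = false) ->
             vbar (bin_in Imp a b) = true)
        & (vbar a = vbar b -> vbar (bin_in Iff a b) = true) /\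
          (vbar a <> vbar b -> vbar (bin_in Iff a b) = false)]).
Proof.
exists (fun a => eval (extend_assignment v) (parse a)); split.
  split=> [A|a b]; first by rewrite parse_sent /= extend_assignmentE.
  rewrite parse_neg !parse_bin /=.
  by case: (eval _ (parse a)); case: (eval _ (parse b)); split; split; intuition.
(* Uniqueness: any [w] meeting the conditions agrees with evaluation at every member, by induction
   on [Sbar S]. *)
move=> w [wsent wcond]; apply/funext; apply: Sbar_ind => [A|a IH|c a b IHa IHb].
- by rewrite parse_sent /= extend_assignmentE wsent.
(* The negation clause stands under a quantifier over two formulas, so [a] fills both places. *)
- rewrite parse_neg /= IH; have [[wF wT] _ _ _ _] := wcond a a.
  by case wa: (w a); [rewrite wT|rewrite wF].
- rewrite parse_bin /= IHa IHb.
  have [_ [A1 A2] [O1 O2] [I1 I2] [E1 E2]] := wcond a b.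
  (* What remains is a truth-table check over the values of [w a] and [w b]. *)
  case: c => /=; apply/esym; move: A1 A2 O1 O2 I1 I2 E1 E2;
    by case: (w a); case: (w b) => /=; intuition congruence.
Qed.
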